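(* Let $S$ be an ordered semigroup. Then $S$ is a nil extension of a left Clifford ordered semigroup if and only if both of the following conditions hold: (1) for all $x, a, y \in S$ there exists $n \in \mathbb{N}$ such that $xa^{n}y \in (xa^{n}ySya^{n}x] \cap (xa^{n}ySxa^{n}y]$; and (2) for all $a \in S$ and $b \in Reg_\leq(S)$, if $a \leq b$ then there exists $z \in S$ such that $a \leq azab$.
   Context: $\mathbb{N}$ is the set of natural numbers (positive integers). An ordered semigroup $(S,\cdot,\leq)$ is a (nonempty) partially ordered set $(S,\leq)$ together with a semigroup structure $(S,\cdot)$ such that for all $a,b,x \in S$, $a \leq b$ implies $xa \leq xb$ and $ax \leq bx$. For $H \subseteq S$, $(H] = \{t \in S : t \leq h \text{ for some } h \in H\}$. For elements $u,v \in S$, $uSv = \{usv : s \in S\}$. A nonempty subset $I \subseteq S$ is an ideal of $S$ if $SI \subseteq I$, $IS \subseteq I$ and $(I] = I$. $S$ is a nil extension of an ideal $I$ if the Rees factor ordered semigroup $S/I$ is nil (every element has some power equal to zero); equivalently, for every $a \in S$ there exists $m \in \mathbb{N}$ with $a^m \in I$. ''$S$ is a nil extension of a left Clifford ordered semigroup'' means that there is an ideal $K$ of $S$ such that $S$ is a nil extension of $K$ and $K$, with the restricted operation and order, is a left Clifford ordered semigroup. $Reg_\leq(S) = \{a \in S : a \in (aSa]\} = \{a \in S : a \leq axa \text{ for some } x \in S\}$ is the set of regular elements of $S$. $S$ is regular if $S = Reg_\leq(S)$. A left Clifford ordered semigroup is a regular ordered semigroup $K$ such that for all $a, b \in K$,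 $ab \in (Ka]$, i.e. there is $x \in K$ with $ab \leq xa$. *)

(* Defs.v *)
From HB Require Import structures.
From mathcomp Require Import all_boot all_order.
From mathcomp Require Import boolp classical_sets.

Set Implicit Arguments.
Unset Strict Implicit.
Unset Printing Implicit Defensive.

Import Order.TTheory.
Local Open Scope order_scope.
Local Open Scope classical_set_scope.
Local Open Scope group_scope.

HB.mixin Record isOrderedSemigroup (d : Order.disp_t) S
    of Order.POrder d S & Semigroup S := {
  osg_inhabited : inhabited S ;
  le_mulg2l : forall x a b : S, a <= b -> x * a <= x * b ;
  le_mulg2r : forall x a b : S, a <= b -> a * x <= b * x
}.

#[short(type="orderedSemigroupType")]
HB.structure Definition OrderedSemigroup (d : Order.disp_t) :=
  {S of isOrderedSemigroup d S & Order.POrder d S & Semigroup S}.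

Section Notions.
Context {d : Order.disp_t} {S : orderedSemigroupType d}.
Implicit Types (a b u v : S) (n : nat).

(* The downset written (H] is the library's [down H]. *)

(* [spow a n] is the n-fold product of a for 0 < n. A semigroup has no unit, so
   the value at 0 is junk (it is a) and every use requires 0 < n. *)
Definition spow a n : S := iterop n *%g a a.

(* uSv *)
Definition sandwich u v : set S := [set u * s * v | s in [set: S]].

(* Ka, for K the whole semigroup *)
Definition lmultiples a : set S := [set s * a | s in [set: S]].

Definition Reg : set S := [set a | down (sandwich a a) a].

Definition is_zero (z : S) :=
  forall a, [/\ z * a = z, a * z = z & z <= a].

End Notions.

Arguments Reg {d} S.

Definition regular d (S : orderedSemigroupType d) := Reg S = [set: S].

Definition left_Clifford d (S : orderedSemigroupType d) :=
  regular S /\ forall a b : S, down (lmultiples a) (a * b).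

Definition nil d (S : orderedSemigroupType d) :=
  exists2 z : S, is_zero z &
    forall a : S, exists n : nat, (0 < n)%N /\ spow a n = z.

Record ideal d (S : orderedSemigroupType d) := Ideal {
  ideal_set :> set S ;
  ideal_neq0 : ideal_set !=set0 ;
  ideal_mull : [set s * i | s in [set: S] & i in ideal_set] `<=` ideal_set ;
  ideal_mulr : [set i * s | i in ideal_set & s in [set: S]] `<=` ideal_set ;
  ideal_down : down ideal_set = ideal_set
}.

Section IdealTheory.
Context {d : Order.disp_t} {S : orderedSemigroupType d} (I : ideal S).
Implicit Types x y : S.

Lemma ideal_memMl x y : y \in (I : set S) -> x * y \in (I : set S).
Proof. by rewrite !inE => Iy; apply: ideal_mull; exists x => //; exists y. Qed.

Lemma ideal_memMr x y : x \in (I : set S) -> x * y \in (I : set S).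
Proof. by rewrite !inE => Ix; apply: ideal_mulr; exists x => //; exists y. Qed.

Lemma ideal_memW x y : x <= y -> y \in (I : set S) -> x \in (I : set S).
Proof. by rewrite !inE => xy Iy; rewrite -ideal_down; exists y; split. Qed.

End IdealTheory.

(* The ideal I as an ordered semigroup, with the operation and order of S. *)
Definition ideal_osg d (S : orderedSemigroupType d) (I : ideal S) : Type :=
  {x : S | x \in (I : set S)}.

Section IdealOsg.
Context {d : Order.disp_t} {S : orderedSemigroupType d} (I : ideal S).
Local Notation T := (ideal_osg I).

HB.instance Definition _ := SubChoice.on T.
HB.instance Definition _ := [SubChoice_isSubPOrder of T by <: with d].

Definition ideal_osg_mul (u v : T) : T :=
  Sub (val u * val v) (ideal_memMl (val u) (valP v)).

Lemma ideal_osg_mulA : associative ideal_osg_mul.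
Proof. by move=> u v w; apply: val_inj => /=; rewrite mulgA. Qed.

HB.instance Definition _ := isSemigroup.Build T ideal_osg_mulA.

Lemma ideal_osg_inhabited : inhabited T.
Proof.
by have [x Ix] := ideal_neq0 I; constructor; exists x; rewrite inE.
Qed.

Lemma ideal_osg_mul2l (x a b : T) : a <= b -> x * a <= x * b.
Proof. exact: (@le_mulg2l d S (val x) (val a) (val b)). Qed.

Lemma ideal_osg_mul2r (x a b : T) : a <= b -> a * x <= b * x.
Proof. exact: (@le_mulg2r d S (val x) (val a) (val b)). Qed.

HB.instance Definition _ := isOrderedSemigroup.Build d T
  ideal_osg_inhabited ideal_osg_mul2l ideal_osg_mul2r.

End IdealOsg.

(* The Rees factor S/I is (S \ I) together with a zero, encoded as [None].
   A product of elements of S \ I that falls into I becomes [None], which is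
   what [insub] returns; the order is that of S on S \ I, with [None] least. *)
Definition rees d (S : orderedSemigroupType d) (I : ideal S) : Type :=
  option {x : S | x \notin (I : set S)}.

Section Rees.
Context {d : Order.disp_t} {S : orderedSemigroupType d} (I : ideal S).
Local Notation Q := (rees I).

HB.instance Definition _ := Choice.on Q.

Definition rees_le (u v : Q) : bool :=
  match u, v with
  | Some x, Some y => val x <= val y
  | None, _ => true
  | Some _, None => false
  end.

Definition rees_mul (u v : Q) : Q :=
  match u, v with
  | Some x, Some y => insub (val x * val y)
  | _, _ => None
  end.

Lemma rees_le_refl : reflexive rees_le.
Proof. by case=> //= x; rewrite lexx. Qed.

Lemma rees_le_anti : antisymmetric rees_le.
Proof. by case=> [x|] [y|] //= /le_anti/val_inj->. Qed.

Lemma rees_le_trans : transitive rees_le.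
Proof. by case=> [y|] [x|] [z|] //=; apply: le_trans. Qed.

HB.instance Definition _ :=
  Order.Le_isPOrder.Build d Q rees_le_refl rees_le_anti rees_le_trans.

Lemma rees_mul_insub x y : rees_mul (insub x) (insub y) = insub (x * y).
Proof.
case: insubP => [u _ <-|/negPn Ix]; last by rewrite /= insubN// negbK ideal_memMr.
case: insubP => [v _ <-|/negPn Iy] //=.
by rewrite insubN// negbK ideal_memMl.
Qed.

Lemma rees_mulA : associative rees_mul.
Proof.
have mN u : rees_mul u None = None by case: u.
case=> [x|] [y|] [z|] //; rewrite ?mN //.
by rewrite -[Some x]valK -[Some y]valK -[Some z]valK !rees_mul_insub mulgA.
Qed.

HB.instance Definition _ := isSemigroup.Build Q rees_mulA.

Lemma rees_inhabited : inhabited Q.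
Proof. by constructor; exact: None. Qed.

Lemma rees_insub_le x y : x <= y -> rees_le (insub x) (insub y).
Proof.
move=> xy; case: insubP => //= u Ix ux; case: insubP => [v _ vy|/negPn Iy] /=.
  by rewrite ux vy.
by rewrite (ideal_memW xy Iy) in Ix.
Qed.

Lemma rees_mul2l (x a b : Q) : a <= b -> x * a <= x * b.
Proof.
by case: x a b => [x|] [a|] [b|] //= ab; apply/rees_insub_le/le_mulg2l.
Qed.

Lemma rees_mul2r (x a b : Q) : a <= b -> a * x <= b * x.
Proof.
by case: x a b => [x|] [a|] [b|] //= ab; apply/rees_insub_le/le_mulg2r.
Qed.

HB.instance Definition _ := isOrderedSemigroup.Build d Q
  rees_inhabited rees_mul2l rees_mul2r.

End Rees.

Definition nil_extension d (S : orderedSemigroupType d) (I : ideal S) :=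
  nil (rees I).

Definition nil_extension_of_left_Clifford d (S : orderedSemigroupType d) :=
  exists K : ideal S, nil_extension K /\ left_Clifford (ideal_osg K).

(* Main.v *)
Require Import Defs.
From mathcomp Require Import all_boot all_order.
From mathcomp Require Import boolp classical_sets.

Import Order.TTheory.

Local Open Scope order_scope.
Local Open Scope classical_set_scope.
Local Open Scope group_scope.

(** For a nil extension [S] of a left Clifford ideal [K], the engine is that in
    [K] a product may be rotated at the cost of a left factor: [a * b] lies
    below a [K]-multiple of [b * a] (lemma [left_Clifford_rotate]).  One of the
    two factors may even be taken outside [K], because an element of [K] can be
    doubled by regularity and one copy absorbed into the outer factor
    ([left_Clifford_rotate_in] and [left_Clifford_rotate_out]).  Hence
    [x * w * y] with [w] in [K] is below a [K]-multiple of [w * y * x], and then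
    of [y * w * x].  With [w] a power of [a] lying in [K], this and the
    regularity of [x * w * y] give (1).  For (2), a regular [b] satisfies
    [b <= (b * s) ^ n * b] for all [n], so [b] is in [K] together with all
    elements below it, and [a <= a * t * a * t * b] becomes
    [a <= a * z * a * b] because [a * t] is below a left multiple of [a].

    Conversely, under (1) and (2) the ideal is the set of regular elements.  By
    (1) some power of each element is regular.  By (2) this set is a downset:
    iterating [a <= a * z * a * b] yields [a <= (a * z) ^ n * a * b ^ n] for all
    [n], and (1) turns the tail [a * b ^ n] into a product ending with [a].
    Writing a regular [a] as [a <= a * (x * a) ^ n], condition (1) shows that
    [s * a] and [a * s] lie below regular elements, and also that [a * b] lies
    below a product ending with [a], which is the left Clifford property. *)

(** * Powers and iterated inequalities *)

Section Powers.
Context {d : Order.disp_t} {S : orderedSemigroupType d}.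
Implicit Types (a b c s u v x : S) (n : nat).

Lemma spowS a n : (0 < n)%N -> spow a n.+1 = a * spow a n.
Proof. by case: n. Qed.

Lemma spowSr a n : (0 < n)%N -> spow a n.+1 = spow a n * a.
Proof.
elim: n => // -[|n] IHn _; first by [].
by rewrite spowS // {1}IHn // mulgA -spowS.
Qed.

Lemma le_spow_mull a c n : (0 < n)%N -> a <= c * a -> a <= spow c n * a.
Proof.
move=> n_gt0 aca; elim: n n_gt0 => // -[|n] IHn _ //.
rewrite spowS // -mulgA; apply: le_trans aca _.
by apply: le_mulg2l; apply: IHn.
Qed.

Lemma le_spow_mulr a c n : (0 < n)%N -> a <= a * c -> a <= a * spow c n.
Proof.
move=> n_gt0 aac; elim: n n_gt0 => // -[|n] IHn _ //.
rewrite spowSr // mulgA; apply: le_trans aac _.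
by apply: le_mulg2r; apply: IHn.
Qed.

Lemma le_mulr_spow x a s n : (0 < n)%N -> a <= a * x * a ->
  a * s <= a * spow (x * a) n * s.
Proof.
by move=> n_gt0 le_a; apply/le_mulg2r/le_spow_mulr; rewrite // mulgA.
Qed.

Lemma le_spow_mul a b c n :
  (0 < n)%N -> a <= c * a * b -> a <= spow c n * a * spow b n.
Proof.
move=> n_gt0 acab; elim: n n_gt0 => // -[|n] IHn _ //.
rewrite (spowS c) // (spowSr b) //.
have -> : c * spow c n.+1 * a * (spow b n.+1 * b)
        = c * (spow c n.+1 * a * spow b n.+1) * b by rewrite !mulgA.
apply: (le_trans acab); apply: le_mulg2r; apply: le_mulg2l.
exact: IHn.
Qed.

Lemma down_sandwichP u v a :
  down (sandwich u v) a <-> exists s : S, a <= u * s * v.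
Proof.
split=> [[_ [[s _ <-] le_a]]|[s le_a]]; first by exists s.
by exists (u * s * v); split=> //; exists s.
Qed.

Lemma RegP a : Reg S a <-> exists s : S, a <= a * s * a.
Proof. exact: down_sandwichP. Qed.

End Powers.

(** * Nil extensions of left Clifford ideals, in elementary terms *)

Section Ideal.
Context {d : Order.disp_t} {S : orderedSemigroupType d} (K : ideal S).
Local Notation K' := (K : set S).

Lemma spow_insub (a : S) n :
  spow (insub a : rees K) n = insub (spow a n).
Proof.
case: n => // n; elim: n => [//|n IHn].
by rewrite (spowS (insub a : rees K)) // (spowS a) // IHn; apply: rees_mul_insub.
Qed.

Lemma nil_extensionP :
  nil_extension K <->
  forall a : S, exists n : nat, (0 < n)%N /\ spow a n \in K'.
Proof.
split=> [[z z0 nilz] a|powK].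
  (* A product with [None] is [None], so the zero is [None]. *)
  have [zE _ _] := z0 None.
  have {}zE : z = None by rewrite -zE; case: (z).
  have [n [n_gt0]] := nilz (insub a); rewrite spow_insub zE => aN.
  exists n; split=> //; apply: contraPT aN => aK.
  by rewrite insubT.
exists None => [a|a]; first by split=> //; case: a.
case: a => [a|]; last by exists 1%N.
have [n [n_gt0 anK]] := powK (val a); exists n; split=> //.
by rewrite -[Some a]valK spow_insub insubN // negbK.
Qed.

Lemma left_Clifford_idealP :
  left_Clifford (ideal_osg K) <->
  (forall a, a \in K' -> exists2 t, t \in K' & a <= a * t * a) /\
  (forall a b, a \in K' -> b \in K' -> exists2 p, p \in K' & a * b <= p * a).
Proof.
split=> [[regK cliffK]|[regK cliffK]].
  split=> [a aK|a b aK bK].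
    have : Reg (ideal_osg K) (Sub a aK) by rewrite regK.
    by move=> /RegP[t le_a]; exists (val t) => //; apply: valP.
  have [_ [[p _ <-] le_ab]] := cliffK (Sub a aK) (Sub b bK).
  by exists (val p) => //; apply: valP.
split=> [|a b].
  apply/seteqP; split=> // a _; apply/RegP.
  have [t tK le_a] := regK _ (valP a).
  by exists (Sub t tK : ideal_osg K).
have [p pK le_ab] := cliffK _ _ (valP a) (valP b).
exists ((Sub p pK : ideal_osg K) * a); split=> //.
by exists (Sub p pK).
Qed.

Lemma Reg_mem_nil_ideal b : nil_extension K -> Reg S b -> b \in K'.
Proof.
move=> /nil_extensionP powK /RegP[s le_b].
have [n [n_gt0 bsK]] := powK (b * s).
apply: (ideal_memW (y := spow (b * s) n * b)); last exact: ideal_memMr.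
exact: le_spow_mull.
Qed.

End Ideal.

(** * Products in a left Clifford ideal *)

Section Necessity.
Context {d : Order.disp_t} {S : orderedSemigroupType d} (K : ideal S).
Local Notation K' := (K : set S).
Hypothesis regK : forall a, a \in K' -> exists2 t, t \in K' & a <= a * t * a.
Hypothesis cliffK :
  forall a b, a \in K' -> b \in K' -> exists2 p, p \in K' & a * b <= p * a.

(** In [a * b <= a * b * s * a * b] the left Clifford law pushes [s] to the left
    of the first [b], creating the factor [b * a], and then removes what follows
    that factor. *)
Lemma left_Clifford_rotate a b : a \in K' -> b \in K' ->
  exists2 p, p \in K' & a * b <= p * (b * a).
Proof.
move=> aK bK.
have [s sK le_ab] := regK _ (ideal_memMl a bK).
have [q qK le_bs] := cliffK _ _ bK sK.
have [r rK le_bab] := cliffK _ _ (ideal_memMl b aK) bK.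
exists (a * q * r); first exact: ideal_memMl.
apply: le_trans le_ab _.
apply: (@le_trans _ _ (a * q * (b * a * b))).
  rewrite -!mulgA; apply: le_mulg2l; rewrite !mulgA.
  by apply: le_mulg2r; apply: le_mulg2r.
by rewrite -[a * q * r * _]mulgA; apply: le_mulg2l.
Qed.

(** With [k <= k * t * k], the element [t * k * y] of [K] can stand for [y]. *)
Lemma left_Clifford_rotate_in k y : k \in K' ->
  exists2 p, p \in K' & k * y <= p * (y * k).
Proof.
move=> kK; have [t tK le_k] := regK _ kK.
have [p pK le_p] := left_Clifford_rotate _ _ kK (ideal_memMr y (ideal_memMl t kK)).
exists (p * (t * k)); first exact: ideal_memMr.
apply: (le_trans (le_mulg2r y _ _ le_k)).
by rewrite !mulgA in le_p *.
Qed.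

(** Rotating the last [k] of [y * k * t * k] to the front gives
    [k * y * (k * t)], where the left Clifford law removes [k * t]. *)
Lemma left_Clifford_rotate_out k y : k \in K' ->
  exists2 p, p \in K' & y * k <= p * (k * y).
Proof.
move=> kK; have [t tK le_k] := regK _ kK.
have ykK := ideal_memMl y kK; have ktK := ideal_memMr t kK.
have [p pK le_p] := left_Clifford_rotate _ _ (ideal_memMr t ykK) kK.
have [q qK le_q] := cliffK _ _ (ideal_memMr y kK) ktK.
exists (p * q); first exact: ideal_memMr.
apply: (le_trans (le_mulg2l y _ _ le_k)).
rewrite -[p * q * _]mulgA; apply: le_trans (le_mulg2l p _ _ le_q).
by rewrite !mulgA in le_p *.
Qed.

(** Cyclic rotation brings [x * w * y] to [w * y * x], and exchanging [w] and [y]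
    there gives [y * w * x]; both steps keep a factor in [K]. *)
Lemma left_Clifford_swap x w y : w \in K' ->
  exists2 p, p \in K' & x * w * y <= p * (y * w * x).
Proof.
move=> wK.
have [p pK le_p] := left_Clifford_rotate_out _ x (ideal_memMr y wK).
have [q qK le_q] := left_Clifford_rotate_in _ y wK.
exists (p * q); first exact: ideal_memMr.
rewrite -mulgA; apply: (le_trans le_p).
rewrite -[p * q * _]mulgA; apply: le_mulg2l.
by rewrite mulgA; apply: le_mulg2r.
Qed.

Lemma left_Clifford_sandwich x w y : w \in K' ->
  (down (sandwich (x * w * y) (y * w * x)) `&`
   down (sandwich (x * w * y) (x * w * y))) (x * w * y).
Proof.
move=> wK; have uK := ideal_memMr y (ideal_memMl x wK).
have [t tK le_u] := regK _ uK.
have [p pK le_p] := left_Clifford_swap x _ y wK.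
split; apply/down_sandwichP; last by exists t.
exists (t * p); apply: (le_trans le_u).
have -> : x * w * y * (t * p) * (y * w * x)
        = x * w * y * t * (p * (y * w * x)) by rewrite !mulgA.
exact: le_mulg2l.
Qed.

Lemma left_Clifford_le_mem a b : a \in K' -> a <= b ->
  exists z : S, a <= a * z * a * b.
Proof.
move=> aK le_b; have [t tK le_a] := regK _ aK.
have [q qK le_q] := cliffK _ _ aK tK.
exists (t * q).
have le_atb : a <= a * t * b by apply: (le_trans le_a); apply: le_mulg2l.
apply: (le_trans le_a); apply: (le_trans (le_mulg2l _ _ _ le_atb)).
have -> : a * (t * q) * a * b = a * t * (q * a * b) by rewrite !mulgA.
by apply: le_mulg2l; apply: le_mulg2r.
Qed.

End Necessity.

(** * The ideal of regular elements *)

Section Sufficiency.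
Context {d : Order.disp_t} {S : orderedSemigroupType d}.
Hypothesis rot : forall x a y : S, exists n : nat, (0 < n)%N /\
  (down (sandwich (x * spow a n * y) (y * spow a n * x)) `&`
   down (sandwich (x * spow a n * y) (x * spow a n * y))) (x * spow a n * y).
Hypothesis le_Reg : forall a b : S,
  Reg S b -> a <= b -> exists z : S, a <= a * z * a * b.

Lemma spow_Reg a : exists n : nat, (0 < n)%N /\ Reg S (spow a n).
Proof.
have [n [n_gt0 [_ reg_u]]] := rot a a a.
by exists n.+2; split=> //; rewrite spowSr // spowS.
Qed.

(** From [a <= (a * z) ^ n.+1 * a * b ^ n.+1], where [n] is the exponent that
    makes [a * b ^ n * b] lie below a product ending with [b * b ^ n * a]. *)
Lemma Reg_le a b : Reg S b -> a <= b -> Reg S a.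
Proof.
move=> regb le_b; have [z le_a] := le_Reg _ _ regb le_b.
have [n [n_gt0 [/down_sandwichP[s le_u] _]]] := rot a b b.
have := le_spow_mul a b (a * z) n.+1 isT le_a.
rewrite (spowS (a * z)) // (spowSr b) // => le_a'; apply/RegP.
exists (z * spow (a * z) n * (a * spow b n * b) * s * b * spow b n).
apply: (le_trans le_a').
have -> : a * z * spow (a * z) n * a * (spow b n * b)
        = a * z * spow (a * z) n * (a * spow b n * b) by rewrite !mulgA.
apply: (le_trans (le_mulg2l _ _ _ le_u)).
by rewrite !mulgA.
Qed.

(** Since [a <= (a * x) ^ n * a] holds for every positive [n], one may use the
    [n] that makes [s * (a * x) ^ n * a] regular. *)
Lemma Reg_mull s a : Reg S a -> Reg S (s * a).
Proof.
move=> /RegP[x le_a]; have [n [n_gt0 [_ reg_u]]] := rot s (a * x) a.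
apply: (Reg_le _ _ reg_u); rewrite -mulgA; apply: le_mulg2l.
exact: le_spow_mull.
Qed.

Lemma Reg_mulr a s : Reg S a -> Reg S (a * s).
Proof.
move=> /RegP[x le_a]; have [n [n_gt0 [_ reg_u]]] := rot a (x * a) s.
by apply: (Reg_le _ _ reg_u); apply: le_mulr_spow.
Qed.

Lemma Reg_neq0 : Reg S !=set0.
Proof.
by have [a] := @osg_inhabited d S; have [n [_ ?]] := spow_Reg a; eexists; eauto.
Qed.

Lemma Reg_ideal_mull : [set s * i | s in [set: S] & i in Reg S] `<=` Reg S.
Proof. by move=> _ [s _ [i regi <-]]; apply: Reg_mull. Qed.

Lemma Reg_ideal_mulr : [set i * s | i in Reg S & s in [set: S]] `<=` Reg S.
Proof. by move=> _ [i regi [s _ <-]]; apply: Reg_mulr. Qed.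

Lemma Reg_down : down (Reg S) = Reg S.
Proof.
apply/seteqP; split=> [a [b [regb le_b]]|a rega]; first exact: Reg_le le_b.
by exists a.
Qed.

Definition Reg_ideal : ideal S :=
  Ideal Reg_neq0 Reg_ideal_mull Reg_ideal_mulr Reg_down.

Lemma nil_extension_Reg : nil_extension Reg_ideal.
Proof.
apply/nil_extensionP => a; have [n [n_gt0 reg_an]] := spow_Reg a.
by exists n; rewrite inE.
Qed.

(** The product [a * b] is below [a * (x * a) ^ n * b], which by (1) is below a
    product ending with [a] whose left part contains that regular element. *)
Lemma left_Clifford_Reg : left_Clifford (ideal_osg Reg_ideal).
Proof.
apply/left_Clifford_idealP; split=> [a|a b]; rewrite !inE => rega.
  have [x le_a] := (RegP a).1 rega.
  (* [x] itself may fail to be regular, unlike [x * a * x]. *)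
  exists (x * a * x); first by rewrite inE; apply/Reg_mulr/Reg_mull.
  apply: (le_trans le_a); apply: (le_trans (le_mulg2l _ _ _ le_a)).
  by rewrite !mulgA.
move=> regb; have [x le_a] := (RegP a).1 rega.
have [n [n_gt0 [/down_sandwichP[s le_u] _]]] := rot a (x * a) b.
exists (a * spow (x * a) n * b * s * b * spow (x * a) n).
  by rewrite inE -!mulgA; apply: Reg_mulr.
apply: (le_trans (le_mulr_spow _ _ b _ n_gt0 le_a)); apply: (le_trans le_u).
by rewrite !mulgA.
Qed.

End Sufficiency.

Theorem theorem3p5 (d : Order.disp_t) (S : orderedSemigroupType d) :
  nil_extension_of_left_Clifford S <->
  (forall x a y : S, exists n : nat, (0 < n)%N /\
     (down (sandwich (x * spow a n * y) (y * spow a n * x)) `&`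
      down (sandwich (x * spow a n * y) (x * spow a n * y)))
       (x * spow a n * y)) /\
  (forall a b : S, Reg S b -> a <= b -> exists z : S, a <= a * z * a * b).
Proof.
split=> [[K [nilK /left_Clifford_idealP[regK cliffK]]]|[rot le_Reg]].
  split=> [x a y|a b regb le_b].
    have [n [n_gt0 anK]] := (nil_extensionP K).1 nilK a.
    by exists n; split=> //; apply: left_Clifford_sandwich anK.
  apply: (left_Clifford_le_mem K) => //.
  exact: ideal_memW le_b (Reg_mem_nil_ideal K _ nilK regb).
exists (Reg_ideal rot le_Reg); split; first exact: nil_extension_Reg.
exact: left_Clifford_Reg.
Qed.
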